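(* Let $(\mathcal N,\tau,\mathcal E,D(\mathcal E))$ be a Dirichlet space with a regular $C^*$-subalgebra $\mathcal A\subseteq\mathcal N$, such that $D(\mathcal E)$ is separable, and let $\partial:D(\mathcal E)\to\mathcal H$ be the associated gradient operator. Assume that a map $F:\mathcal H\to\mathcal H$ satisfies, for some $\theta>0$, $$\Re\langle F(h)-F(v),h-v\rangle_{\mathcal H}\ge\theta\|h-v\|_{\mathcal H}^2\qquad\text{for all } h,v\in\mathcal H.$$ Let $f\in D(\mathcal E)$. Then the equation $\partial^*F(\partial u)=f$ has at most one weak solution in $D_0(\mathcal E):=D(\mathcal E)/\ker\mathcal E$; that is, if $u_1,u_2\in D(\mathcal E)$ both satisfy $$\langle F(\partial u_i),\partial g\rangle_{\mathcal H}=\langle f,g\rangle_{L^2(\tau)}\qquad\text{for all } g\in D(\mathcal E),$$ then $u_1-u_2\in\ker\mathcal E$.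
   Context: All inner products and sesquilinear forms are conjugate-linear in the first and linear in the second variable. Dirichlet space. $\mathcal N$ is a $W^*$-algebra with a normal faithful semi-finite trace $\tau$; $L^2(\tau)$ is the completion of $\mathfrak n:=\{a\in\mathcal N:\tau(a^*a)<\infty\}$ for $\langle a,b\rangle_{L^2(\tau)}=\tau(a^*b)$. A Markov semigroup on $\mathcal N$ is a family $(P_t)_{t\ge0}$ of completely positive, contractive, unital linear maps $\mathcal N\to\mathcal N$ with $P_{t+s}=P_tP_s$, $P_0=\mathrm{id}$, and $P_t(a)\to a$ weak$^*$ as $t\to0$ for every $a\in\mathcal N$. The trace $\tau$ is symmetric for it if $\tau(aP_t(b))=\tau(P_t(a)b)$ for $a,b\in\mathcal N^+$, $t\ge0$. Then $(P_t)$ induces a strongly continuous self-adjoint contraction semigroup $e^{-t\Delta_{(2)}}$ on $L^2(\tau)$, with $\Delta_{(2)}\ge0$ self-adjoint. The associated (completely) Dirichlet form is the closed Hermitian form $\mathcal E$ with domain $D(\mathcal E)=D(\Delta_{(2)}^{1/2})$ and $\mathcal E(a,b)=\langle a,\Delta_{(2)}b\rangle_{L^2(\tau)}$ for $a,b\in D(\Delta_{(2)})$; write $\mathcal E[a]=\mathcal E(a,a)$. $D(\mathcal E)$ is a Hilbert space with $\langle a,b\rangle_{\mathcal E}:=\langle a,b\rangle_{L^2(\tau)}+\mathcal E(a,b)$. The quadruple $(\mathcal N,\tau,\mathcal E,D(\mathcal E))$ obtained this way is called a Dirichlet space. Regular subalgebra. A $C^*$-subalgebra $\mathcal A\subseteq\mathcal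 N$ is regular if: (1) $\tau|_{\mathcal A}$ is a faithful norm-semi-finite trace (the positive elements of $\mathcal A$ of finite trace span a norm-dense subspace of $\mathcal A$); (2) $\mathcal A\cap\mathfrak n$ is norm dense in $\mathcal A$; (3) $\mathcal A\cap D(\mathcal E)$ is norm dense in $\mathcal A$; (4) $\mathcal A\cap D(\mathcal E)$ is dense in $D(\mathcal E)$ for $\langle\cdot,\cdot\rangle_{\mathcal E}$. Then $\mathcal B:=\mathcal A\cap D(\mathcal E)$ is a $*$-algebra. Gradient operator (a known construction of Cipriani–Sauvageot). $\mathcal H$ is the Hilbert space obtained from $\mathcal B\otimes\mathcal B$ by dividing out the null space and completing with respect to the positive semi-definite form $$\langle c\otimes d,a\otimes b\rangle_{\mathcal H}=\tfrac12\big(\mathcal E(c,abd^* )+\mathcal E(cdb^*,a)-\mathcal E(db^*,c^*a)\big).$$ It is a Hilbert $\mathcal A$-bimodule with $c(a\otimes b)=(ca)\otimes b-c\otimes(ab)$, $(b\otimes c)a=b\otimes(ca)$ for $a,b,c\in\mathcal B$. There is a derivation $\partial:\mathcal B\to\mathcal H$ with $\partial(a)b=a\otimes b$ and $\mathcal E(a,b)=\langle\partial a,\partial b\rangle_{\mathcal H}$, closable from $L^2(\tau)$ to $\mathcal H$; its closure, again denoted $\partial$, has domain $D(\mathcal E)$ and satisfies $\mathcal E(u,v)=\langle\partial u,\partial v\rangle_{\mathcal H}$ for $u,v\in D(\mathcal E)$. $\partial^*$ is its adjoint. $\ker\mathcal E:=\{u\in D(\mathcal E):\mathcal E[u]=0\}$,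 and $D_0(\mathcal E)=D(\mathcal E)/\ker\mathcal E$ carries the inner product $\mathcal E(\cdot,\cdot)$. Since $\partial u$ depends only on the class of $u$ in $D_0(\mathcal E)$, the notion of weak solution makes sense for classes in $D_0(\mathcal E)$. *)

(* Defs.v *)
From HB Require Import structures.
From mathcomp Require Import all_boot all_order all_algebra.
From mathcomp Require Import complex.
From mathcomp Require Import all_classical all_reals all_analysis.

Set Implicit Arguments.
Unset Strict Implicit.
Unset Printing Implicit Defensive.

Import Order.TTheory GRing.Theory Num.Theory numFieldNormedType.Exports.

Local Open Scope classical_set_scope.
Local Open Scope complex_scope.
Local Open Scope ring_scope.

(* Linear in the second variable, hence conjugate-linear in the first one. *)
HB.mixin Record isHilbert (R : realType) (U : Type)
    of CompleteNormedModule R[i] U := {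
  inner : U -> U -> R[i];
  inner_linear : forall x : U, scalar (inner x);
  inner_conj : forall x y : U, inner y x = Num.conj (inner x y);
  inner_norm : forall x : U, inner x x = `|x| ^+ 2
}.
#[short(type="hilbertType")]
HB.structure Definition Hilbert (R : realType) :=
  {U of CompleteNormedModule R[i] U & isHilbert R U}.

(* Unital C*-algebras.  The product is a field of the mixin because the library
   has no common substructure of rings and normed modules below NumDomain, so
   that HB refuses their join.  The zero algebra is allowed. *)
HB.mixin Record isCStar (R : realType) (A : Type)
    of CompleteNormedModule R[i] A := {
  cmul : A -> A -> A;
  cone : A;
  star : A -> A;
  cmul_linearl : forall b : A, linear (fun a : A => cmul a b);
  cmul_linearr : forall a : A, linear (cmul a);
  cmulA : forall a b c : A, cmul a (cmul b c) = cmul (cmul a b) c;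
  cmul1l : forall a : A, cmul cone a = a;
  cmul1r : forall a : A, cmul a cone = a;
  starK : forall a : A, star (star a) = a;
  star_antilinear : forall (k : R[i]) (a b : A),
    star (k *: a + b) = Num.conj k *: star a + star b;
  starM : forall a b : A, star (cmul a b) = cmul (star b) (star a);
  cnormM : forall a b : A, `|cmul a b| <= `|a| * `|b|;
  cnorm_star : forall a : A, `|cmul (star a) a| = `|a| ^+ 2
}.
#[short(type="cstarAlgType")]
HB.structure Definition CStar (R : realType) :=
  {A of CompleteNormedModule R[i] A & isCStar R A}.

(* W*-algebras in the sense of Sakai: a C*-algebra isometric, through
   a |-> (pairing ^~ a), to the dual of a Banach space.  The weak* topology is
   that of pointwise convergence on the predual. *)
HB.mixin Record isWStar (R : realType) (N : Type) of CStar R N := {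
  predual : completeNormedModType R[i];
  pairing : predual -> N -> R[i];
  pairing_linearl : forall a : N, scalar (fun x : predual => pairing x a);
  pairing_linearr : forall x : predual, scalar (pairing x);
  pairing_le : forall (x : predual) (a : N), `|pairing x a| <= `|x| * `|a|;
  pairing_isometric : forall (a : N) (M : R[i]), 0 <= M ->
    (forall x : predual, `|pairing x a| <= M * `|x|) -> `|a| <= M;
  pairing_onto : forall phi : {scalar predual}, continuous phi ->
    exists a : N, forall x : predual, phi x = pairing x a
}.
#[short(type="wstarAlgType")]
HB.structure Definition WStar (R : realType) :=
  {N of CStar R N & isWStar R N}.

Local Notation "a ** b" := (cmul a b) (at level 40, left associativity).

Section Positivity.
Context {R : realType} {N : cstarAlgType R}.

Definition cpos : set N := [set a | exists b : N, a = star b ** b].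

Definition cle (a b : N) : Prop := cpos (b - a).

(* Positivity in the C*-algebra of n x n matrices over N. *)
Definition mx_pos (n : nat) (M : 'M[N]_n) : Prop :=
  exists X : 'M[N]_n, forall i j, M i j = \sum_(k < n) star (X k i) ** X k j.

Definition completely_positive (Phi : N -> N) : Prop :=
  forall (n : nat) (M : 'M[N]_n), mx_pos M -> mx_pos (map_mx Phi M).

Record cstar_subalgebra (A : set N) : Prop := {
  csub0 : A 0;
  csub_linear : forall (k : R[i]) (a b : N), A a -> A b -> A (k *: a + b);
  csubM : forall a b : N, A a -> A b -> A (a ** b);
  csub_star : forall a : N, A a -> A (star a);
  csub_closed : closed A
}.

End Positivity.

Definition linear_span (R : realType) (V : normedModType R[i]) (S : set V) :
    set V :=
  [set x | exists n (c : 'I_n -> R[i]) (v : 'I_n -> V),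
     (forall i, S (v i)) /\ x = \sum_(i < n) c i *: v i].

Section Traces.
Context {R : realType} {N : cstarAlgType R}.
Implicit Types tau : N -> \bar R.

(* Only the values of tau on the positive cone are meaningful. *)
Record trace tau : Prop := {
  trace_ge0 : forall a : N, cpos a -> (0 <= tau a)%E;
  traceD : forall a b : N, cpos a -> cpos b ->
    tau (a + b) = (tau a + tau b)%E;
  traceZ : forall (r : R) (a : N), 0 <= r -> cpos a ->
    tau (r%:C *: a) = (r%:E * tau a)%E;
  trace_comm : forall a : N, tau (star a ** a) = tau (a ** star a)
}.

Definition trace_faithful tau : Prop :=
  forall a : N, cpos a -> tau a = 0%E -> a = 0.

Definition trace_semifinite tau : Prop :=
  forall a : N, cpos a -> a <> 0 ->
    exists b : N, [/\ cpos b, b <> 0, cle b a & (tau b < +oo)%E].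

(* tau commutes with suprema of bounded upward directed families. *)
Definition trace_normal tau : Prop :=
  forall (D : set N) (s : N),
    D !=set0 -> D `<=` cpos ->
    (forall a b : N, D a -> D b -> exists c : N, [/\ D c, cle a c & cle b c]) ->
    (forall a : N, D a -> cle a s) ->
    (forall b : N, (forall a : N, D a -> cle a b) -> cle s b) ->
    tau s = ereal_sup (tau @` D).

(* The ideal of square-integrable elements, written n in gothic type. *)
Definition sqint tau : set N := [set a | (tau (star a ** a) < +oo)%E].

(* The linear extension of tau to the span of the positive elements of finite
   trace: x = p0 + i p1 - p2 - i p3 |-> tau p0 + i tau p1 - tau p2 - i tau p3. *)
Definition trace_lin tau (x : N) : R[i] :=
  xget 0 [set z | exists p : 'I_4 -> N,
    [/\ forall k, cpos (p k) /\ (tau (p k) < +oo)%E,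
        x = \sum_(k < 4) 'i ^+ k *: p k &
        z = \sum_(k < 4) 'i ^+ k * (fine (tau (p k)))%:C]].

(* Lam is the inclusion of the square-integrable elements in their completion. *)
Record is_L2 tau (L2 : hilbertType R) (Lam : N -> L2) : Prop := {
  L2_linear : forall (k : R[i]) (a b : N), sqint tau a -> sqint tau b ->
    Lam (k *: a + b) = k *: Lam a + Lam b;
  L2_inner : forall a b : N, sqint tau a -> sqint tau b ->
    inner (Lam a) (Lam b) = trace_lin tau (star a ** b);
  L2_dense : dense (Lam @` sqint tau)
}.

End Traces.

Section MarkovSemigroups.
Context {R : realType} {N : wstarAlgType R}.
Implicit Types (P : R -> N -> N) (tau : N -> \bar R).

Record markov_semigroup P : Prop := {
  markov_linear : forall t : R, 0 <= t -> linear (P t);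
  markov_cp : forall t : R, 0 <= t -> completely_positive (P t);
  markov_contractive : forall (t : R) (a : N), 0 <= t -> `|P t a| <= `|a|;
  markov_unital : forall t : R, 0 <= t -> P t cone = cone;
  markovD : forall (t s : R) (a : N), 0 <= t -> 0 <= s ->
    P (t + s) a = P t (P s a);
  markov0 : forall a : N, P 0 a = a;
  markov_weakstar : forall (a : N) (x : predual),
    (pairing x (P t a) : R[i]^o) @[t --> 0^'+] --> (pairing x a : R[i]^o)
}.

(* tau (a P_t(b)) = tau (P_t(a) b) for positive a = r^2 and b = s^2; as usual,
   tau (a c) stands for tau (a^(1/2) c a^(1/2)) when a and c are positive. *)
Definition trace_symmetric tau P : Prop :=
  forall (t : R) (r s : N), 0 <= t -> cpos r -> cpos s ->
    tau (r ** P t (s ** s) ** r) = tau (s ** P t (r ** r) ** s).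

End MarkovSemigroups.

Section Forms.
Context {R : realType} {L2 : hilbertType R}.

(* Unbounded operators of L2 are given by their graphs. *)
Implicit Types (G S : set (L2 * L2)) (T : R -> L2 -> L2).
Implicit Types (E : L2 -> L2 -> R[i]) (DE : set L2).

(* Delta, for T t = e^(-t Delta). *)
Definition generator T : set (L2 * L2) :=
  [set z | (t^-1)%:C *: (z.1 - T t z.1) @[t --> 0^'+] --> z.2].

Definition op_dom S : set L2 := [set x | exists y, S (x, y)].

Definition op_adjoint S : set (L2 * L2) :=
  [set z | forall w, S w -> inner z.1 w.2 = inner z.2 w.1].

Definition self_adjoint S : Prop := dense (op_dom S) /\ op_adjoint S = S.

Definition is_op_sqrt G S : Prop :=
  [/\ self_adjoint S,
      forall z, S z -> 0 <= inner z.1 z.2 &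
      forall x z, G (x, z) <-> exists y, S (x, y) /\ S (y, z)].

(* The square of the norm of <u, v>_E = <u, v> + E(u, v). *)
Definition form_norm2 E (u : L2) : R[i] := inner u u + E u u.

Definition form_dense DE E (C : set L2) : Prop :=
  C `<=` DE /\
  forall (u : L2) (e : R[i]), DE u -> 0 < e ->
    exists v, C v /\ form_norm2 E (u - v) < e.

Definition form_separable DE E : Prop :=
  exists C : set L2, countable C /\ form_dense DE E C.

Definition form_closed DE E : Prop :=
  forall u : nat -> L2, (forall n, DE (u n)) ->
    (forall e : R[i], 0 < e -> exists n0 : nat, forall m n : nat,
       (n0 <= m)%N -> (n0 <= n)%N -> form_norm2 E (u m - u n) < e) ->
    exists v, DE v /\ (form_norm2 E (u n - v) : R[i]^o) @[n --> \oo] --> (0 : R[i]^o).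

(* The values of E outside DE are irrelevant. *)
Record form_of_semigroup T DE E : Prop := {
  form_dom : exists S, is_op_sqrt (generator T) S /\ DE = op_dom S;
  form_linear : forall (k : R[i]) (u v w : L2), DE u -> DE v -> DE w ->
    E u (k *: v + w) = k * E u v + E u w;
  form_conj : forall u v : L2, DE u -> DE v -> E v u = Num.conj (E u v);
  form_ge0 : forall u : L2, DE u -> 0 <= E u u;
  form_complete : form_closed DE E;
  form_generator : forall a b w : L2, op_dom (generator T) a ->
    generator T (b, w) -> E a b = inner a w
}.

Definition form_ker DE E : set L2 := [set u | DE u /\ E u u = 0].

End Forms.

Section DirichletSpaces.
Context {R : realType} {N : wstarAlgType R} {L2 : hilbertType R}.
Implicit Types (tau : N -> \bar R) (Lam : N -> L2).
Implicit Types (DE : set L2) (E : L2 -> L2 -> R[i]).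

(* T t is the continuous extension of P t from the square-integrable elements;
   it is determined by P and inherits from it the semigroup law, self-adjointness
   and strong continuity. *)
Record induced_semigroup tau Lam (P : R -> N -> N) (T : R -> L2 -> L2) :
    Prop := {
  induced_linear : forall t : R, 0 <= t -> linear (T t);
  induced_contractive : forall (t : R) (u : L2), 0 <= t -> `|T t u| <= `|u|;
  induced_sqint : forall (t : R) (a : N), 0 <= t -> sqint tau a ->
    sqint tau (P t a);
  induced_ext : forall (t : R) (a : N), 0 <= t -> sqint tau a ->
    T t (Lam a) = Lam (P t a)
}.

Record dirichlet_space tau Lam DE E : Prop := {
  ds_trace : trace tau;
  ds_normal : trace_normal tau;
  ds_faithful : trace_faithful tau;
  ds_semifinite : trace_semifinite tau;
  ds_L2 : is_L2 tau Lam;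
  ds_form : exists P : R -> N -> N,
    [/\ markov_semigroup P, trace_symmetric tau P &
        exists T : R -> L2 -> L2,
          induced_semigroup tau Lam P T /\ form_of_semigroup T DE E]
}.

(* B, the intersection of A with D(E); an element of N belongs to L2 exactly when
   it is square-integrable. *)
Definition form_alg tau Lam DE (A : set N) : set N :=
  [set a | [/\ A a, sqint tau a & DE (Lam a)]].

Record regular_subalgebra tau Lam DE E (A : set N) : Prop := {
  reg_subalgebra : cstar_subalgebra A;
  reg_faithful : forall a : N, A a -> cpos a -> tau a = 0%E -> a = 0;
  reg_semifinite :
    A `<=` closure (linear_span [set a | [/\ A a, cpos a & (tau a < +oo)%E]]);
  reg_sqint : A `<=` closure (A `&` sqint tau);
  reg_form : A `<=` closure (form_alg tau Lam DE A);
  reg_core : form_dense DE E (Lam @` form_alg tau Lam DE A)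
}.

End DirichletSpaces.

Section Gradient.
Context {R : realType} {N : wstarAlgType R}.

(* Left and right actions of A by commuting bounded *-(anti)representations;
   lact a h is a h, and ract a h is h a. *)
Record hilbert_bimodule (A : set N) (H : hilbertType R)
    (lact ract : N -> H -> H) : Prop := {
  lact_linear : forall a : N, A a -> linear (lact a);
  lact_linearl : forall (k : R[i]) (a b : N) (h : H), A a -> A b ->
    lact (k *: a + b) h = k *: lact a h + lact b h;
  lactM : forall (a b : N) (h : H), A a -> A b ->
    lact (a ** b) h = lact a (lact b h);
  lact_star : forall (a : N) (h v : H), A a ->
    inner (lact a h) v = inner h (lact (star a) v);
  lact_bounded : forall (a : N) (h : H), A a -> `|lact a h| <= `|a| * `|h|;
  ract_linear : forall a : N, A a -> linear (ract a);
  ract_linearl : forall (k : R[i]) (a b : N) (h : H), A a -> A b ->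
    ract (k *: a + b) h = k *: ract a h + ract b h;
  ractM : forall (a b : N) (h : H), A a -> A b ->
    ract (a ** b) h = ract b (ract a h);
  ract_star : forall (a : N) (h v : H), A a ->
    inner (ract a h) v = inner h (ract (star a) v);
  ract_bounded : forall (a : N) (h : H), A a -> `|ract a h| <= `|a| * `|h|;
  lract_comm : forall (a b : N) (h : H), A a -> A b ->
    ract b (lact a h) = lact a (ract b h)
}.

(* The Cipriani-Sauvageot construction, up to unitary equivalence: H is the
   separated completion of the tensor square of B, tens a b being the class of
   a (x) b, and the operator d from L2 to H with domain DE is the closure of the
   derivation a |-> d (Lam a) on B.  The identity E(u, v) = <d u, d v> is stated
   on B only; it extends to DE since B is a core. *)
Record gradient_operator (tau : N -> \bar R) (L2 : hilbertType R)
    (Lam : N -> L2) (DE : set L2) (E : L2 -> L2 -> R[i]) (A : set N)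
    (H : hilbertType R) (tens : N -> N -> H) (lact ract : N -> H -> H)
    (d : L2 -> H) : Prop := {
  tens_linearl : forall (k : R[i]) (a a' b : N), form_alg tau Lam DE A a ->
    form_alg tau Lam DE A a' -> form_alg tau Lam DE A b ->
    tens (k *: a + a') b = k *: tens a b + tens a' b;
  tens_linearr : forall (k : R[i]) (a b b' : N), form_alg tau Lam DE A a ->
    form_alg tau Lam DE A b -> form_alg tau Lam DE A b' ->
    tens a (k *: b + b') = k *: tens a b + tens a b';
  tens_inner : forall a b c e : N, form_alg tau Lam DE A a ->
    form_alg tau Lam DE A b -> form_alg tau Lam DE A c ->
    form_alg tau Lam DE A e ->
    inner (tens c e) (tens a b) =
      2^-1 * (E (Lam c) (Lam (a ** b ** star e))
            + E (Lam (c ** e ** star b)) (Lam a)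
            - E (Lam (e ** star b)) (Lam (star c ** a)));
  tens_dense : dense (linear_span
    [set h | exists a b, [/\ form_alg tau Lam DE A a, form_alg tau Lam DE A b &
                             h = tens a b]]);
  grad_bimodule : hilbert_bimodule A lact ract;
  lact_tens : forall a b c : N, form_alg tau Lam DE A a ->
    form_alg tau Lam DE A b -> form_alg tau Lam DE A c ->
    lact c (tens a b) = tens (c ** a) b - tens c (a ** b);
  ract_tens : forall a b c : N, form_alg tau Lam DE A a ->
    form_alg tau Lam DE A b -> form_alg tau Lam DE A c ->
    ract a (tens b c) = tens b (c ** a);
  grad_linear : forall (k : R[i]) (u v : L2), DE u -> DE v ->
    d (k *: u + v) = k *: d u + d v;
  grad_derivation : forall a b : N, form_alg tau Lam DE A a ->
    form_alg tau Lam DE A b ->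
    d (Lam (a ** b)) = lact a (d (Lam b)) + ract b (d (Lam a));
  grad_tens : forall a b : N, form_alg tau Lam DE A a ->
    form_alg tau Lam DE A b -> ract b (d (Lam a)) = tens a b;
  grad_form : forall a b : N, form_alg tau Lam DE A a ->
    form_alg tau Lam DE A b ->
    E (Lam a) (Lam b) = inner (d (Lam a)) (d (Lam b));
  grad_closure : [set (u, d u) | u in DE] =
    closure [set (Lam a, d (Lam a)) | a in form_alg tau Lam DE A]
}.

End Gradient.

(* u is a weak solution of d^* F(d u) = f. *)
Definition weak_solution (R : realType) (L2 H : hilbertType R) (DE : set L2)
    (d : L2 -> H) (F : H -> H) (f u : L2) : Prop :=
  DE u /\ forall g : L2, DE g -> inner (F (d u)) (d g) = inner f g.

(* Main.v *)
Require Import Defs.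
From HB Require Import structures.
From mathcomp Require Import all_boot all_order all_algebra.
From mathcomp Require Import complex ring.
From mathcomp Require Import all_classical all_reals all_analysis.
Import Order.TTheory GRing.Theory Num.Theory numFieldNormedType.Exports.
Local Open Scope classical_set_scope.
Local Open Scope complex_scope.
Local Open Scope ring_scope.

(** Testing both equations against [g = u1 - u2] and subtracting shows that
    [inner (F (d u1) - F (d u2)) (d u1 - d u2)] vanishes, so that strong
    monotonicity of [F] forces [d w = 0] for [w = u1 - u2].  It remains to see
    that [w] has zero energy.

    The identity [E a b = inner (d a) (d b)] is known on the core [form_alg] and
    has to be carried over to [w].  Since [(w, 0)] lies on the graph of [d], which
    is the closure of its restriction to the core, there are core elements [u]
    arbitrarily close to [w] in [L2] whose energy [E u u = `|d u| ^+ 2] is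
    arbitrarily small ([grad_null_approx]).  A sequence of such elements is Cauchy
    for the form norm, by the parallelogram law, so it converges in that norm
    because the form is closed; its limit can only be [w], and the energy of the
    limit is the limit of the energies, namely zero ([form_ker_of_approx]). *)

Section NonnegativeForms.
Set Implicit Arguments.
Unset Strict Implicit.
Context {R : realType} {V : lmodType R[i]}.

(** The inner product (on the whole space) and a form [E] (on its domain) are both
    of this kind, so that the parallelogram law is proved once for the two. *)
Record nonneg_form (D : set V) (E : V -> V -> R[i]) : Prop := {
  nf_dom : forall (k : R[i]) (u v : V), D u -> D v -> D (k *: u + v);
  nf_linear : forall (k : R[i]) (u v w : V), D u -> D v -> D w ->
    E u (k *: v + w) = k * E u v + E u w;
  nf_conj : forall u v : V, D u -> D v -> E v u = Num.conj (E u v);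
  nf_ge0 : forall u : V, D u -> 0 <= E u u
}.

Context {D : set V} {E : V -> V -> R[i]} (nfE : nonneg_form D E).

Lemma nf_domB (x y : V) : D x -> D y -> D (x - y).
Proof. by move=> hx hy; rewrite addrC -scaleN1r; exact: (nf_dom nfE). Qed.

Lemma nf_linearl (k : R[i]) (x y z : V) : D x -> D y -> D z ->
  E (k *: x + y) z = Num.conj k * E x z + E y z.
Proof.
move=> hx hy hz; have hk := nf_dom nfE k hx hy.
rewrite (nf_conj nfE hz hk) (nf_linear nfE)// rmorphD rmorphM/=.
by rewrite -!(nf_conj nfE).
Qed.

Lemma nf_expand (k : R[i]) (x y : V) : D x -> D y ->
  E (k *: x + y) (k *: x + y) =
  k * Num.conj k * E x x + k * E y x + Num.conj k * E x y + E y y.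
Proof.
move=> hx hy; rewrite (nf_linear nfE) ?nf_linearl//; last exact: (nf_dom nfE).
by ring.
Qed.

(** The difference of the two sides is [E (x + y) (x + y)], by the parallelogram
    law. *)
Lemma nf_sqrB_le (x y : V) : D x -> D y ->
  E (x - y) (x - y) <= 2 * E x x + 2 * E y y.
Proof.
move=> hx hy; have := nf_ge0 nfE (nf_dom nfE 1 hy hx).
rewrite [x - y]addrC -scaleN1r !nf_expand// rmorphN1 rmorph1 => h.
rewrite -subr_ge0; apply: le_trans h _; rewrite le_eqVlt; apply/orP; left.
by apply/eqP; ring.
Qed.

End NonnegativeForms.

Section HilbertSpaces.
Context {R : realType} {V : hilbertType R}.
Set Implicit Arguments.
Unset Strict Implicit.

Lemma nonneg_form_inner : nonneg_form [set: V] inner.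
Proof.
split=> // [k u v w _ _ _|u v _ _|u _]; first exact: inner_linear.
  exact: inner_conj.
by rewrite inner_norm exprn_ge0.
Qed.

Lemma innerBl (x y z : V) : inner (x - y) z = inner x z - inner y z.
Proof.
rewrite addrC -scaleN1r (nf_linearl nonneg_form_inner)// rmorphN1 mulN1r.
by rewrite addrC.
Qed.

Lemma sqr_normB_le (x y : V) :
  `|x - y| ^+ 2 <= 2 * `|x| ^+ 2 + 2 * `|y| ^+ 2.
Proof. by rewrite -!inner_norm; exact: (nf_sqrB_le nonneg_form_inner). Qed.

Lemma op_adjoint_linear (S : set (V * V)) (k : R[i]) (z z' : V * V) :
  op_adjoint S z -> op_adjoint S z' -> op_adjoint S (k *: z + z').
Proof.
move=> hz hz' w Sw /=.
by rewrite !(nf_linearl nonneg_form_inner)// (hz w Sw) (hz' w Sw).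
Qed.

Lemma self_adjoint_dom (S : set (V * V)) (k : R[i]) (x y : V) :
  self_adjoint S -> op_dom S x -> op_dom S y -> op_dom S (k *: x + y).
Proof.
move=> [_ SE] [x' Sx] [y' Sy]; exists (k *: x' + y'); move: Sx Sy; rewrite -SE.
exact: op_adjoint_linear.
Qed.

(** The domain is a subspace as the domain of the self-adjoint square root of the
    generator, and a self-adjoint graph is an adjoint, hence a subspace. *)
Lemma nonneg_form_of_semigroup (T : R -> V -> V) (DE : set V) E :
  form_of_semigroup T DE E -> nonneg_form DE E.
Proof.
move=> fs; split.
- have [S [[Ssa _ _] ->]] := form_dom fs.
  by move=> k u v; exact: self_adjoint_dom.
- exact: (form_linear fs).
- exact: (form_conj fs).
- exact: (form_ge0 fs).
Qed.

Lemma complex_archimedean (e : R[i]) : 0 < e ->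
  exists n0 : nat, forall n, (n0 <= n)%N -> n.+1%:R^-1 < e.
Proof.
move=> e0; have /complex_realP[r er] : e \is Num.real by exact: gtr0_real.
move: e0; rewrite er ltcR => r0; exists (Num.truncn r^-1) => n hn.
rewrite -(rmorph_nat (real_complex R)) -fmorphV ltcR invf_plt ?posrE//.
by rewrite (lt_le_trans (truncnS_gt _))// ler_nat.
Qed.

(** Elements of small energy that are close to a common point [w] of the ambient
    space are close to each other for the form norm. *)
Lemma form_norm2B_le (D : set V) (E : V -> V -> R[i]) (w x y : V) :
  nonneg_form D E -> D x -> D y ->
  form_norm2 E (x - y) <=
    2 * (`|w - x| ^+ 2 + E x x) + 2 * (`|w - y| ^+ 2 + E y y).
Proof.
move=> nfE Dx Dy; rewrite !mulrDr addrACA /form_norm2 inner_norm.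
apply: lerD; last exact: (nf_sqrB_le nfE).
have -> : x - y = (w - y) - (w - x) by rewrite opprB [RHS]addrC addrA subrK.
by rewrite [leRHS]addrC sqr_normB_le.
Qed.

(** Lower semicontinuity of a closed form, in the case of zero energy.  That [w]
    lies in the domain is part of the conclusion.  The quantity
    [`|w - u| ^+ 2 + E u u] controls distance and energy at once: if it is small
    for [u], and [u] is close to [v] for the form norm, then it is small for [v];
    its vanishing at the limit [v] says that [v = w] and [E v v = 0]. *)
Lemma form_ker_of_approx (D : set V) (E : V -> V -> R[i]) (w : V) :
  nonneg_form D E -> form_closed D E ->
  (forall e, 0 < e -> exists u, D u /\ `|w - u| ^+ 2 + E u u < e) ->
  form_ker D E w.
Proof.
move=> nfE closedE approx.
have lt4 (a b e : R[i]) : a < e / 4 -> b < e / 4 -> 2 * a + 2 * b < e.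
  move=> ae be; rewrite -mulrDr (lt_le_trans (_ : _ < 2 * (e / 4 + e / 4)))//.
    by rewrite ltr_pM2l// ltrD.
  by rewrite le_eqVlt; apply/orP; left; apply/eqP; field.
have r0 n : 0 < n.+1%:R^-1 :> R[i] by rewrite invr_gt0 ltr0Sn.
have /choice[u Hu] : forall n, exists v,
    D v /\ `|w - v| ^+ 2 + E v v < n.+1%:R^-1.
  by move=> n; exact: approx.
have Du n : D (u n) by have [] := Hu n.
have u_lt e : 0 < e -> exists n0 : nat, forall n, (n0 <= n)%N ->
    `|w - u n| ^+ 2 + E (u n) (u n) < e.
  move=> e0; have [n0 Hn0] := complex_archimedean e0; exists n0 => n hn.
  by apply: lt_trans (Hn0 n hn); have [] := Hu n.
have [|v [Dv uv]] := closedE u Du.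
  move=> e e0; have [n0 Hn0] := u_lt (e / 4) (divr_gt0 e0 (ltr0n _ 4)).
  exists n0 => m n hm hn; apply: le_lt_trans (form_norm2B_le w nfE _ _) _ => //.
  by apply: lt4; exact: Hn0.
have limE e : 0 < e -> `|w - v| ^+ 2 + E v v < e.
  move=> e0; have e4 : 0 < e / 4 by rewrite divr_gt0.
  have [n0 Hn0] := u_lt _ e4.
  have /cvgrPdist_lt/(_ _ e4)[n1 _ Hn1] := uv.
  have hu := Hn0 _ (leq_maxl n0 n1); have /= := Hn1 _ (leq_maxr n0 n1).
  move: hu; set x := u _; have Dx : D x by exact: Du.
  have Dxv : D (x - v) by exact: (nf_domB nfE).
  rewrite sub0r normrN ger0_norm; last first.
    by rewrite addr_ge0 ?inner_norm ?exprn_ge0 ?(nf_ge0 nfE).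
  move=> hx hxv; apply: le_lt_trans (lt4 _ _ _ hx hxv).
  rewrite !mulrDr addrACA; apply: lerD; last first.
    by have := nf_sqrB_le nfE Dx Dxv; rewrite subKr.
  rewrite inner_norm -[`|x - v|]normrN opprB.
  by have := sqr_normB_le (w - x) (v - x); rewrite opprB addrA subrK.
have Ev0 := nf_ge0 nfE Dv.
have : `|w - v| ^+ 2 + E v v = 0.
  (* The order of R[i] is partial, so take the positive quantity itself as e. *)
  apply/eqP/negPn/negP => Q0; suff /limE : 0 < `|w - v| ^+ 2 + E v v.
    by rewrite ltxx.
  by rewrite lt_def Q0 addr_ge0 ?exprn_ge0.
move/eqP; rewrite paddr_eq0 ?exprn_ge0// sqrf_eq0 normr_eq0 subr_eq0.
by move=> /andP[/eqP -> /eqP].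
Qed.

End HilbertSpaces.

Section GradientKernel.
Set Implicit Arguments.
Unset Strict Implicit.

(** The point [(w, 0)] of the graph is a limit of points [(Lam a, d (Lam a))] with
    [a] in the core, where the energy is [`|d (Lam a)| ^+ 2]. *)
Lemma grad_null_approx (R : realType) (N : wstarAlgType R) (tau : N -> \bar R)
    (L2 H : hilbertType R) (Lam : N -> L2) (DE : set L2) (E : L2 -> L2 -> R[i])
    (A : set N) (tens : N -> N -> H) (lact ract : N -> H -> H) (d : L2 -> H) :
  gradient_operator tau Lam DE E A tens lact ract d ->
  forall w, DE w -> d w = 0 ->
  forall e, 0 < e -> exists u, DE u /\ `|w - u| ^+ 2 + E u u < e.
Proof.
move=> hd w Dw dw0 e e0.
have : closure [set (Lam a, d (Lam a)) | a in form_alg tau Lam DE A] (w, d w).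
  by rewrite -(grad_closure hd); exists w.
pose r := sqrtC (e / 2); have r0 : 0 < r by rewrite sqrtC_gt0 divr_gt0.
rewrite dw0 => /(_ (ball w r `*` ball (0 : H) r)); case.
  by exists (ball w r, ball (0 : H) r) => //=; split; exact: nbhsx_ballx.
move=> _ [[a [Aa qa Da] <-] []] /=.
rewrite -!ball_normE /= sub0r normrN => h1 h2; exists (Lam a); split=> //.
rewrite (grad_form hd)// inner_norm.
have sq x : 0 <= x -> x < r -> x ^+ 2 < e / 2.
  by move=> x0 xr; rewrite -(sqrtCK (e / 2)) ltrXn2r.
rewrite [e]splitr; apply: ltrD; exact: sq.
Qed.

End GradientKernel.

Theorem theorem9p5 (R : realType) (N : wstarAlgType R) (tau : N -> \bar R)
    (L2 : hilbertType R) (Lam : N -> L2)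
    (DE : set L2) (E : L2 -> L2 -> R[i])
    (hDS : dirichlet_space tau Lam DE E)
    (A : set N) (hA : regular_subalgebra tau Lam DE E A)
    (hsep : form_separable DE E)
    (H : hilbertType R) (tens : N -> N -> H) (lact ract : N -> H -> H)
    (d : L2 -> H)
    (hd : gradient_operator tau Lam DE E A tens lact ract d)
    (F : H -> H) (theta : R) (htheta : 0 < theta)
    (hF : forall h v : H,
      theta%:C * `|h - v| ^+ 2 <= 'Re (inner (F h - F v) (h - v)))
    (f : L2) (hf : DE f) (u1 u2 : L2)
    (hu1 : weak_solution DE d F f u1) (hu2 : weak_solution DE d F f u2) :
  form_ker DE E (u1 - u2).
Proof.
have [P [_ _ [T [_ fs]]]] := ds_form hDS.
have nfE := nonneg_form_of_semigroup fs.
have [[D1 sol1] [D2 sol2]] := (hu1, hu2).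
have Dw : DE (u1 - u2) by exact: (nf_domB nfE).
have dB : d (u1 - u2) = d u1 - d u2.
  by rewrite addrC -scaleN1r (grad_linear hd)// scaleN1r addrC.
apply: (form_ker_of_approx nfE (form_complete fs)).
apply: (grad_null_approx hd Dw); rewrite dB; apply/eqP.
have := hF (d u1) (d u2); rewrite innerBl -dB sol1// sol2// subrr dB raddf0.
rewrite pmulr_rle0 ?ltcR// => h.
by rewrite -normr_eq0 -sqrf_eq0 eq_le h exprn_ge0.
Qed.
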